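(* Let $K$ be a field, $X=\{x_1,\ldots,x_n\}$, let $\sigma$ be a permutation of $\{1,\ldots,n\}$ of order $k$ with $\operatorname{char}(K)\nmid k$, and let $I\subseteq K[X]$ be a $\sigma$-symmetric ideal. Then the algorithm symmStd described in the context, applied to $(I,\sigma)$, terminates and is correct, i.e. its output $G$ is a Gröbner basis of the input $I$.
   Context: A permutation $\sigma$ of $\{1,\ldots,n\}$ acts on $K[X]=K[x_1,\ldots,x_n]$ as the $K$-algebra automorphism $x_i\mapsto x_{\sigma(i)}$, also denoted $\sigma$. An ideal $I\subseteq K[X]$ is $\sigma$-symmetric if $\sigma(I)=I$. For $k=\operatorname{ord}(\sigma)$ it is assumed that $\operatorname{char}(K)\nmid k$ and that $K$ has a primitive $k$-th root of unity $\xi_k$; the latter is achieved by possibly adjoining $\xi_k$, namely by working over $K[a]/\Phi_k(a)$, where $\Phi_k$ is the $k$-th cyclotomic polynomial. Gröbner bases are taken with respect to a fixed degree ordering $>$ (a monomial ordering in which a monomial of larger total degree is larger), and are always assumed reduced: $0\notin G$; the leading monomial of $g$ does not divide the leading monomial of $f$ for distinct $f,g\in G$; every $g\in G$ has leading coefficient $1$; and no monomial of $g$ minus its leading term lies in the leading ideal of $G$. Let std denote a procedure which computes the Gröbner basis of its input ideal. Algorithm symmStd. Input: an ideal $I\subseteq K[X]$ and a permutation $\sigma$ of $\{1,\ldots,n\}$ such that $I$ is $\sigma$-symmetric. Output: $G\subseteq K[X]$, the Gröbner basis of $I$. 1. Set $k=\operatorname{ord}(\sigma)$. 2. If $k \bmod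 \operatorname{char}(K)=0$, print a warning that the algorithm is not applicable and return $\emptyset$. 3. If $k=2$ or $(\operatorname{char}(K)-1)\bmod k=0$, compute a primitive $k$-th root of unity $\xi_k\in K$; else set $K=K[a]/\Phi_k(a)$ and $\xi_k:=a$. 4. Compute the automorphism $\tau$ of $K[X]$ defined as follows. Write $\sigma=\sigma_1\cdots\sigma_\vartheta$ in cycle decomposition (fixed points being cycles of length $1$), $\sigma_m=(e_{m,1}\ldots e_{m,l_m})$, put $\xi_{l_m}:=\xi_k^{k/l_m}$, and set $$\tau(x_{e_{m,i}})=\sum_{j=1}^{l_m}\xi_{l_m}^{(i-1)(j-1)}\,x_{\sigma_m^{j-1}(e_{m,i})}\qquad(1\le m\le\vartheta,\ 1\le i\le l_m).$$ 5. Compute $G_\tau=\mathrm{std}(I_\tau)$, where $I_\tau:=\tau(I)$. 6. Compute $G=\mathrm{std}(\langle\tau^{-1}(G_\tau)\rangle)$. 7. Return $G$.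
   Formalization: In step 3, K[a]/Φ_k(a) is read as K[a]/h(a) with h any monic irreducible factor of Φ_k over K (h = Φ_k if Φ_k is irreducible), since otherwise K[a]/Φ_k(a) is not a field (e.g. K = ℂ, k = 3) and reduced Gröbner bases over it are undefined. *)

(* Defs.v *)
From HB Require Import structures.
From mathcomp Require Import all_boot all_order all_algebra.
From mathcomp Require Import all_fingroup all_field.
From mathcomp Require Import mpoly.

Set Implicit Arguments.
Unset Strict Implicit.
Unset Printing Implicit Defensive.

Import GRing.Theory.
Local Open Scope ring_scope.

(* MathComp only provides the predicate [pchar R] of the prime characteristics
   of R; characteristic zero means that there is none. *)
Definition has_char (R : nzRingType) (c : nat) : Prop :=
  if c is 0%N then [pchar R] =i pred0 else c \in [pchar R].

Section Ideals.
Variable A : comNzRingType.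

(* MathComp's idealr_closed describes proper ideals only, whereas the unit
   ideal has to be allowed here. *)
Definition is_ideal (I : A -> Prop) : Prop :=
  [/\ I 0, forall f g, I f -> I g -> I (f + g) & forall a f, I f -> I (a * f)].

Definition ideal_gen (S : A -> Prop) (f : A) : Prop :=
  exists2 s : seq (A * A),
    (forall p, p \in s -> S p.2) & f = \sum_(p <- s) p.1 * p.2.

End Ideals.

Definition image_set (A B : Type) (f : A -> B) (S : A -> Prop) (b : B) : Prop :=
  exists2 a, S a & b = f a.

Section Groebner.
Variable n : nat.

Definition degree_ordering (le : rel 'X_{1..n}) : Prop :=
  [/\ reflexive le, antisymmetric le, transitive le & total le] /\
  (forall m m1 m2, le m1 m2 -> le (m + m1)%MM (m + m2)%MM) /\
  (forall m1 m2, (mdeg m1 < mdeg m2)%N -> le m1 m2).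

Variables (le : rel 'X_{1..n}) (K : fieldType).
Implicit Types (f g : {mpoly K[n]}) (G : seq {mpoly K[n]}).

(* The library's mlead is tied to one particular ordering.  For a degree
   ordering 0%MM is the least monomial, so that this is the le-greatest element
   of the support of f, and 0%MM when f = 0. *)
Definition lead_mon f : 'X_{1..n} :=
  foldr (fun m1 m2 => if le m1 m2 then m2 else m1) 0%MM (msupp f).

Definition lead_cf f : K := f@_(lead_mon f).

Definition lead_term f : {mpoly K[n]} := lead_cf f *: 'X_[lead_mon f].

Definition lead_ideal (S : {mpoly K[n]} -> Prop) : {mpoly K[n]} -> Prop :=
  ideal_gen (fun h => exists f, [/\ S f, f != 0 & h = 'X_[lead_mon f]]).

Definition groebner_basis (I : {mpoly K[n]} -> Prop) G : Prop :=
  (forall g, g \in G -> I g) /\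
  (forall h, lead_ideal (fun g => g \in G) h <-> lead_ideal I h).

Definition reduced G : Prop :=
  [/\ 0 \notin G,
      forall f g, f \in G -> g \in G -> f != g ->
        ~~ (lead_mon g <= lead_mon f)%MM,
      forall g, g \in G -> lead_cf g = 1
    & forall g m, g \in G -> m \in msupp (g - lead_term g) ->
        ~ lead_ideal (fun f => f \in G) 'X_[m] ].

Definition reduced_groebner_basis (I : {mpoly K[n]} -> Prop) G : Prop :=
  groebner_basis I G /\ reduced G.

End Groebner.

Definition symmetric_ideal (n : nat) (K : fieldType) (sigma : 'S_n)
    (I : {mpoly K[n]} -> Prop) : Prop :=
  forall f, image_set (msym sigma) I f <-> I f.

(* A list of cycles (e_1 ... e_l), each given as the sequence of its entries,
   so that sigma e_i = e_(i+1); fixed points are cycles of length 1. *)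
Definition cycle_decomposition (n : nat) (sigma : 'S_n)
    (cs : seq (seq 'I_n)) : bool :=
  [&& perm_eq (flatten cs) (enum 'I_n), [::] \notin cs & all (fcycle sigma) cs].

Section Tau.
Variables (n : nat) (L : fieldType) (k : nat) (xi : L) (cs : seq (seq 'I_n)).

Definition cycle_of (e : 'I_n) : seq 'I_n :=
  nth [::] cs (find (fun c => e \in c) cs).

(* If e is the i-th entry of its cycle c, then index e c = i - 1; moreover
   next c is the cyclic permutation c, and j is shifted by one. *)
Definition tau_var (e : 'I_n) : {mpoly L[n]} :=
  let c := cycle_of e in
  let xi_l := xi ^+ (k %/ size c) in
  \sum_(j < size c) xi_l ^+ (index e c * j) *: 'X_(iter j (next c) e).

Definition tau (f : {mpoly L[n]}) : {mpoly L[n]} :=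
  f \mPo [tuple tau_var e | e < n].

End Tau.

(* Nondeterministic programs: Compute P k obtains some x such that P x and
   continues with k x; it is stuck if there is no such x. *)
Inductive program (A : Type) : Type :=
| Return of A
| Compute (X : Type) of (X -> Prop) & (X -> program A).

Arguments Return {A} _.
Arguments Compute {A} [X] _ _.

(* No execution gets stuck, and every execution is finite and returns a value
   satisfying Q. *)
Inductive terminates_with (A : Type) (Q : A -> Prop) : program A -> Prop :=
| TerminatesReturn a : Q a -> terminates_with Q (Return a)
| TerminatesCompute (X : Type) (P : X -> Prop) (k : X -> program A) :
    (exists x, P x) -> (forall x, P x -> terminates_with Q (k x)) ->
    terminates_with Q (Compute P k).

(* The algorithm may replace K by an extension, over which its output list is
   then represented. *)
Record output (K : fieldType) (n : nat) : Type := Output {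
  out_field : fieldType;
  out_emb : {rmorphism K -> out_field};
  out_basis : seq {mpoly out_field[n]}
}.

Section SymmStd.
Variables (n : nat) (K : fieldType).
Variable std :
  forall L : fieldType, ({mpoly L[n]} -> Prop) -> seq {mpoly L[n]}.
Variables (I : {mpoly K[n]} -> Prop) (sigma : 'S_n).

Definition symmStd_over (L : fieldType) (iota : {rmorphism K -> L})
    (xi : L) : program (output K n) :=
  let k := #[sigma]%g in
  let IL : {mpoly L[n]} -> Prop := ideal_gen (image_set (map_mpoly iota) I) in
  Compute (fun cs => cycle_decomposition sigma cs) (fun cs =>
  let t := tau k xi cs in
  Compute (fun t' => cancel t t' /\ cancel t' t) (fun t' =>
  let Gt := std (image_set t IL) in
  let G := std (ideal_gen (fun f => f \in [seq t' g | g <- Gt])) in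
  Return (Output iota G))).

(* c is the characteristic of K.  In characteristic 0, k %% 0 = k is nonzero,
   and c - 1 has to be taken in int.  K[a]/Phi_k(a) is a field only if Phi_k is
   irreducible over K; in general a is a root of an arbitrary monic irreducible
   factor h of Phi_k, which is Phi_k itself when Phi_k is irreducible. *)
Definition symmStd (c : nat) : program (output K n) :=
  let k := #[sigma]%g in
  if (k %% c == 0)%N then Return (Output (idfun : {rmorphism K -> K}) [::])
  else if (k == 2)%N || (((c%:Z - 1) %% k%:Z)%Z == 0) then
    Compute (fun xi : K => k.-primitive_root xi) (fun xi =>
    symmStd_over (idfun : {rmorphism K -> K}) xi)
  else
    Compute (fun hh : {h : {poly K} | monic_irreducible_poly h} =>
               sval hh %| map_poly intr 'Phi_k) (fun hh =>
    let L : fieldType := {poly %/ sval hh with svalP hh} in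
    symmStd_over (qpolyC (sval hh) : {rmorphism K -> L}) ('qX : L)).

End SymmStd.

(* Main.v *)
(* Over a field L that contains a primitive k-th root of unity, tau is
   invertible because on a cycle of length l its matrix is a diagonal matrix
   times the Vandermonde matrix of the l-th roots of unity.  A Groebner basis
   generates its ideal, so that tau^-1(G_tau) generates the ideal I_L that I
   generates over L, and G is the reduced Groebner basis of I_L.  The reduced
   Groebner basis of I over K is also one of I_L: a K-linear functional L -> K
   applied to the coefficients of an element of I_L yields an element of I, and
   it preserves the leading monomial if it does not kill the leading coefficient.
   Uniqueness of reduced Groebner bases then shows that G has coefficients in
   K. *)

Require Import Defs.
From HB Require Import structures.
From mathcomp Require Import all_boot all_order all_algebra.
From mathcomp Require Import all_fingroup all_field.
From mathcomp Require Import cyclic.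
From mathcomp Require Import mpoly.
From Stdlib Require Classical_Prop.

Set Implicit Arguments.
Unset Strict Implicit.
Unset Printing Implicit Defensive.

Import GRing.Theory.
Local Open Scope ring_scope.

(** * Generated ideals *)

Section Ideals.
Variable A : comNzRingType.
Implicit Types (S J : A -> Prop) (f : A).

Lemma ideal_sum J (s : seq (A * A)) : is_ideal J ->
  (forall p, p \in s -> J p.2) -> J (\sum_(p <- s) p.1 * p.2).
Proof.
move=> [J0 JD JM] sJ; rewrite big_seq.
by elim/big_ind: _ => // p /sJ; apply: JM.
Qed.

Lemma ideal_gen_min S J f : is_ideal J ->
  (forall x, S x -> J x) -> ideal_gen S f -> J f.
Proof. by move=> Jid SJ [s sS ->]; apply: ideal_sum => // p /sS /SJ. Qed.

Lemma mem_ideal_gen S f : S f -> ideal_gen S f.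
Proof.
by exists [:: (1, f)] => [p|]; rewrite ?big_seq1 ?mul1r // inE => /eqP->.
Qed.

Lemma ideal_gen_is_ideal S : is_ideal (ideal_gen S).
Proof.
split=> [|f g [s sS ->] [t tS ->]|a f [s sS ->]].
- by exists [::]; rewrite ?big_nil.
- exists (s ++ t); rewrite ?big_cat // => p.
  by rewrite mem_cat => /orP[/sS|/tS].
exists [seq (a * p.1, p.2) | p <- s] => [p /mapP[q /sS Sq ->] //|].
by rewrite big_map mulr_sumr; apply: eq_bigr => p _; rewrite mulrA.
Qed.

Lemma idealB J f g : is_ideal J -> J f -> J g -> J (f - g).
Proof. by move=> [_ JD JM] Jf Jg; apply: JD; rewrite // -mulN1r; apply: JM. Qed.

End Ideals.

(** * Degree orderings on monomials *)

Section MonomialOrder.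
Variables (n : nat) (le : rel 'X_{1..n}).
Hypothesis le_deg : degree_ordering le.

Lemma mon_le_refl : reflexive le. Proof. by have [[]] := le_deg. Qed.
Lemma mon_le_anti : antisymmetric le. Proof. by have [[]] := le_deg. Qed.
Lemma mon_le_trans : transitive le. Proof. by have [[]] := le_deg. Qed.
Lemma mon_le_total : total le. Proof. by have [[]] := le_deg. Qed.

Lemma mon_le_add m m1 m2 : le m1 m2 -> le (m + m1)%MM (m + m2)%MM.
Proof. by have [_ [+ _]] := le_deg; apply. Qed.

Lemma mon_le0 m : le 0%MM m.
Proof.
have [-> | m0] := eqVneq m 0%MM; first exact: mon_le_refl.
by have [_ [_]] := le_deg; apply; rewrite mdeg0 lt0n mdeg_eq0.
Qed.

Lemma mon_le_mdeg m1 m2 : le m1 m2 -> (mdeg m1 <= mdeg m2)%N.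
Proof.
move=> le12; rewrite leqNgt; apply/negP => lt21.
have [_ [_ /(_ _ _ lt21) le21]] := le_deg.
by move: lt21; rewrite (mon_le_anti (introT andP (conj le12 le21))) ltnn.
Qed.

(* Below a given monomial there are only finitely many. *)
Lemma mon_lt_ind (P : 'X_{1..n} -> Prop) :
  (forall m, (forall m', le m' m -> m' != m -> P m') -> P m) -> forall m, P m.
Proof.
move=> IH m; have [D ltD] : exists D, (mdeg m < D)%N by exists (mdeg m).+1.
(* Monomials below [m] have at most its degree, so one bound [D] serves throughout; the induction is
   on the number of elements of a finite type that lie strictly below [m]. *)
pose below m := [pred x : 'X_{1..n < D} | le x m & bmnm x != m].
have [r] := ubnP #|below m|; elim: r m ltD => // r IHr m ltD ltr.
apply: IH => m' lem' m'm; have ltD' := leq_ltn_trans (mon_le_mdeg lem') ltD.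
apply: (IHr _ ltD'); apply: leq_trans _ (ltnSE ltr).
apply: proper_card; apply/properP; split.
  apply/subsetP => x; rewrite !inE => /andP[lex xm'].
  rewrite (mon_le_trans lex lem'); apply: contraNneq xm' => xm.
  by apply/eqP/mon_le_anti; rewrite lex xm.
exists (BMultinom ltD'); rewrite !inE /= ?eqxx ?andbF //.
by rewrite lem'.
Qed.

(** * Leading monomials and reduced Gröbner bases *)

Section LeadingMonomial.
Variable K : fieldType.
Implicit Types (f g : {mpoly K[n]}) (m : 'X_{1..n}).
Implicit Types (J : {mpoly K[n]} -> Prop) (G : seq {mpoly K[n]}).

Fact foldr_lead_max (s : seq 'X_{1..n}) :
  let M := foldr (fun m1 m2 => if le m1 m2 then m2 else m1) 0%MM s in
  (M \in 0%MM :: s) /\ forall m, m \in s -> le m M.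
Proof.
elim: s => [|x s [IHm IHle]] /=; first by split; rewrite ?inE.
set M := foldr _ _ _ in IHm IHle *.
have [lexM | ] := boolP (le x M).
  split=> [|m]; first by move: IHm; rewrite !inE => /orP[]->; rewrite ?orbT.
  by rewrite inE => /predU1P[->|/IHle].
move=> nle; have leM : le M x by case/orP: (mon_le_total x M) nle => ->.
split=> [|m]; first by rewrite !inE eqxx orbT.
rewrite inE => /predU1P[->|/IHle]; first exact: mon_le_refl.
by move/mon_le_trans; apply.
Qed.

Lemma mon_le_lead f m : m \in msupp f -> le m (lead_mon le f).
Proof. by have [_] := foldr_lead_max (msupp f); apply. Qed.

Lemma lead_mon_supp f : f != 0 -> lead_mon le f \in msupp f.
Proof.
move=> f0; have [] := foldr_lead_max (msupp f); rewrite -/(lead_mon le f).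
rewrite inE => /predU1P[lead0 le_lead|//].
(* If the fold gives [0%MM], the least monomial, then every monomial of the support equals it, so it
   does occur. *)
case Ef: (msupp f) => [|m s] in le_lead *.
  by rewrite -msupp_eq0 Ef in f0.
have := le_lead m (mem_head _ _).
rewrite lead0 => /(conj (mon_le0 m)) /andP /mon_le_anti ->.
exact: mem_head.
Qed.

Lemma lead_mon_eq f m : m \in msupp f ->
  (forall m', m' \in msupp f -> le m' m) -> lead_mon le f = m.
Proof.
move=> mf m_max; apply/mon_le_anti; rewrite mon_le_lead // m_max //.
by apply: lead_mon_supp; apply: contraTneq mf => ->; rewrite msupp0.
Qed.

Lemma lead_cf_neq0 f : f != 0 -> lead_cf le f != 0.
Proof. by move/lead_mon_supp; rewrite mcoeff_msupp. Qed.

(** A monomial occurring in a combination of monomial generators occurs in one of the multiples,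
    hence is divisible by that generator. *)
Lemma lead_ideal_monP (S : {mpoly K[n]} -> Prop) m :
  lead_ideal le S 'X_[m] <->
  exists f, [/\ S f, f != 0 & (lead_mon le f <= m)%MM].
Proof.
split=> [[s sS Em] | [f [Sf f0 fm]]]; last first.
  exists [:: ('X_[m - lead_mon le f], 'X_[lead_mon le f])] => [p|].
    by rewrite inE => /eqP-> /=; exists f.
  by rewrite big_seq1 /= -mpolyXD submK.
have: m \in msupp (\sum_(p <- s) p.1 * p.2) by rewrite -Em msuppX mem_head.
elim: s sS {Em} => [|p s IHs] sS; first by rewrite big_nil msupp0.
rewrite big_cons => /msuppD_le; rewrite mem_cat => /orP[mp|].
  have [f [Sf f0 Ep]] := sS p (mem_head _ _).
  exists f; split=> //; move: mp; rewrite Ep (perm_mem (msuppMX _ _)).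
  by case/mapP=> m' _ ->; apply: lem_addr.
by apply: IHs => q qs; apply: sS; rewrite inE qs orbT.
Qed.

(** The divisibility criterion. [g != 0] is recorded because [lead_mon] of [0] is [0%MM], which
    divides every monomial. *)
Lemma groebnerP J G : groebner_basis le J G <->
  (forall g, g \in G -> J g) /\
  forall f, J f -> f != 0 ->
    exists2 g, g \in G & (g != 0) && (lead_mon le g <= lead_mon le f)%MM.
Proof.
split=> [[GJ GB]|[GJ GB]]; split=> //.
  move=> f Jf f0; have: lead_ideal le J 'X_[lead_mon le f].
    by apply/lead_ideal_monP; exists f; split; rewrite ?lepm_refl.
  by move/GB/lead_ideal_monP => [g [gG g0 gf]]; exists g; rewrite ?g0.
move=> h; split; apply: ideal_gen_min; try exact: ideal_gen_is_ideal.
  by move=> _ [f [/GJ Jf f0 ->]]; apply/mem_ideal_gen; exists f.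
move=> _ [f [Jf f0 ->]]; have [g gG /andP[g0 gf]] := GB f Jf f0.
by apply/lead_ideal_monP; exists g.
Qed.

(** Division algorithm: a multiple [h] of some [g] in [G] cancels the leading term of [f], and
    [f - h] is zero or has a smaller leading monomial. *)
Lemma groebner_generates J G f : is_ideal J -> groebner_basis le J G ->
  J f -> ideal_gen (fun g => g \in G) f.
Proof.
move=> Jid /groebnerP[GJ GB]; have [_ _ JM] := Jid.
have [G0 GD GM] := ideal_gen_is_ideal (fun g => g \in G).
move Em: (lead_mon le f) => m.
elim/mon_lt_ind: m f Em => m IHm f Em Jf; have [-> // | f0] := eqVneq f 0.
have [g gG /andP[g0]] := GB f Jf f0; rewrite Em => gm.
have lg0 := lead_cf_neq0 g0.
set a := lead_cf le f / lead_cf le g.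
set h := (a *: 'X_[m - lead_mon le g]) * g.
have Gh : ideal_gen (fun g => g \in G) h by apply/GM/mem_ideal_gen.
rewrite -[f](subrK h); apply: GD => //.
have [-> // | fh0] := eqVneq (f - h) 0.
have Jfh : J (f - h) by apply: idealB => //; apply/JM/GJ.
have hE m' : h@_m' = a * (g * 'X_[m - lead_mon le g])@_m'.
  by rewrite /h -scalerAl mcoeffZ [g * _]mulrC.
apply: (IHm (lead_mon le (f - h))) => //.
  have /msuppB_le := lead_mon_supp fh0; rewrite mem_cat => /orP[].
    by move/mon_le_lead; rewrite Em.
  rewrite mcoeff_msupp hE mulf_eq0 negb_or => /andP[_].
  rewrite -mcoeff_msupp (perm_mem (msuppMX _ _)) => /mapP[m' m'g ->].
  by rewrite -{2}(submK gm) mon_le_add ?mon_le_lead.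
apply: contraTneq (lead_mon_supp fh0) => ->.
rewrite -mcoeff_eq0 mcoeffB hE -{2}(submK gm) mcoeffMX.
by rewrite divfK // -Em subrr.
Qed.

(** Used in both directions, this is uniqueness of reduced bases. Minimality pairs [g] with some
    [g'] of the same leading monomial; a nonzero [g - g'] would have its leading monomial in the
    tail of [g] or of [g'], which reducedness keeps out of the leading ideal. *)
Lemma reduced_groebner_sub J G G' : is_ideal J ->
  reduced_groebner_basis le J G -> reduced_groebner_basis le J G' ->
  {subset G <= G'}.
Proof.
move=> Jid [GB [G0 Gmin Gmonic Gred]] [GB' [G'0 G'min G'monic G'red]] g gG.
have [GJ GBdiv] := (groebnerP J G).1 GB.
have [G'J GBdiv'] := (groebnerP J G').1 GB'.
have g0 : g != 0 by apply: contraNneq G0 => <-.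
have [g' g'G' /andP[g'0 g'g]] := GBdiv' g (GJ _ gG) g0.
have [g2 g2G /andP[_ g2g']] := GBdiv g' (G'J _ g'G') g'0.
have g2E : g2 = g.
  apply/eqP; apply: contraTT (lepm_trans g2g' g'g) => ne.
  by apply: Gmin => //; rewrite eq_sym.
have lead_eq : lead_mon le g = lead_mon le g'.
  apply/mnmP => i; apply/eqP; rewrite eqn_leq -{1}g2E.
  by rewrite (mnm_lepP g2g') (mnm_lepP g'g).
have [gg'|] := eqVneq (g - g') 0; first by rewrite (subr0_eq gg').
move=> d0; have Jd : J (g - g') by apply: idealB; auto.
have : lead_ideal le J 'X_[lead_mon le (g - g')].
  by apply/lead_ideal_monP; exists (g - g'); split; rewrite ?lepm_refl.
have dE : g - g' = (g - lead_term le g) - (g' - lead_term le g').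
  by rewrite /lead_term Gmonic // G'monic // lead_eq !scale1r opprB addrA subrK.
move: (lead_mon_supp d0) => md lJ; have := md; rewrite {2}dE => /msuppB_le.
rewrite mem_cat => /orP[] mg; first by case: (Gred _ _ gG mg); apply/GB.2.
by case: (G'red _ _ g'G' mg); apply/GB'.2.
Qed.

Lemma eq_reduced_groebner_basis J J' G : (forall f, J f <-> J' f) ->
  reduced_groebner_basis le J G -> reduced_groebner_basis le J' G.
Proof.
move=> JJ' [/groebnerP[GJ GB] Gred]; split=> //; apply/groebnerP.
by split=> [g /GJ /JJ' // | f /JJ']; apply: GB.
Qed.

Lemma eq_mem_reduced_groebner_basis J G G' : G =i G' ->
  reduced_groebner_basis le J G -> reduced_groebner_basis le J G'.
Proof.
move=> GG' [/groebnerP[GJ GB] [G0 Gmin Gmonic Gred]]; split.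
  apply/groebnerP; split=> [g|f Jf f0]; first by rewrite -GG' => /GJ.
  by have [g] := GB f Jf f0; rewrite GG'; exists g.
split=> [|f g|g|g m]; rewrite -?GG' //; [exact: Gmin | exact: Gmonic |].
move=> gG mg /lead_ideal_monP[f [fG f0 fm]]; apply: Gred gG mg _.
by apply/lead_ideal_monP; exists f; rewrite GG'.
Qed.

End LeadingMonomial.

(** * Extension of the coefficient field *)

Section FieldExtension.
Variables (K L : fieldType) (iota : {rmorphism K -> L}).
Implicit Types (I : {mpoly K[n]} -> Prop) (f : {mpoly K[n]}).

Lemma msupp_iota f : msupp (map_mpoly iota f) =i msupp f.
Proof. by move=> m; rewrite !mcoeff_msupp mcoeff_map_mpoly fmorph_eq0. Qed.

Lemma map_mpoly_inj : injective (@map_mpoly n K L iota).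
Proof.
move=> f g Efg; apply/mpolyP => m; apply: (fmorph_inj iota).
by rewrite -!mcoeff_map_mpoly Efg.
Qed.

Lemma map_mpoly_iota_eq0 f : (map_mpoly iota f == 0) = (f == 0).
Proof. by rewrite -(inj_eq map_mpoly_inj) raddf0. Qed.

Lemma lead_mon_iota f : lead_mon le (map_mpoly iota f) = lead_mon le f.
Proof.
have [-> | f0] := eqVneq f 0; first by rewrite raddf0 /lead_mon !msupp0.
apply: lead_mon_eq => [|m]; rewrite msupp_iota; first exact: lead_mon_supp.
exact: mon_le_lead.
Qed.

Definition extend_ideal I : {mpoly L[n]} -> Prop :=
  ideal_gen (image_set (map_mpoly iota) I).

(** By additivity it suffices to treat [b *: 'X_[m] * map_mpoly iota f] with [f] in [I], which [phi]
    sends, coefficient by coefficient, to [(phi b *: 'X_[m]) * f]. *)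
Lemma map_functional_ideal I (phi : {additive L -> K}) h : is_ideal I ->
  (forall a x, phi (iota a * x) = a * phi x) ->
  extend_ideal I h -> I (map_mpoly phi h).
Proof.
move=> [I0 ID IM] phiZ [s sI ->]; rewrite raddf_sum big_seq.
elim/big_ind: _ => // p /sI[f If ->]; rewrite [p.1]mpolyE mulr_suml raddf_sum.
elim/big_ind: _ => //= m _.
suff -> : map_mpoly phi (p.1@_m *: 'X_[m] * map_mpoly iota f)
   = (phi p.1@_m *: 'X_[m]) * f by apply: IM.
apply/mpolyP => m'; rewrite mcoeff_map_mpoly -!scalerAl !mcoeffZ.
rewrite -(map_mpolyX iota) -rmorphM /= mcoeff_map_mpoly.
by rewrite mulrC phiZ mulrC.
Qed.

(** This takes the place of a [K]-basis of [L]: the identity serves for [L = K], a coefficient of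
    the representative for the quotient field. *)
Hypothesis separating : forall x : L, x != 0 ->
  exists phi : {additive L -> K},
    (forall a y, phi (iota a * y) = a * phi y) /\ phi x != 0.

Lemma lead_mon_extend_ideal I h : is_ideal I -> extend_ideal I h -> h != 0 ->
  exists f, [/\ I f, f != 0 & lead_mon le f = lead_mon le h].
Proof.
move=> Iid Ih h0; have [phi [phiZ phi0]] := separating (lead_cf_neq0 h0).
have lead_phi : lead_mon le h \in msupp (map_mpoly phi h).
  by rewrite mcoeff_msupp mcoeff_map_mpoly.
exists (map_mpoly phi h); split; first exact: map_functional_ideal.
  by apply: contraTneq lead_phi => ->; rewrite msupp0.
apply: lead_mon_eq => // m; rewrite mcoeff_msupp mcoeff_map_mpoly => phim0.
by apply: mon_le_lead; rewrite mcoeff_msupp; apply: contraNneq phim0 => ->;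
  rewrite raddf0.
Qed.

(** [iota] keeps supports and leading monomials, so reducedness carries over; by
    [lead_mon_extend_ideal] the extended ideal has no new leading monomials. *)
Lemma reduced_groebner_extend I G : is_ideal I ->
  reduced_groebner_basis le I G ->
  reduced_groebner_basis le (extend_ideal I) [seq map_mpoly iota g | g <- G].
Proof.
move=> Iid [/groebnerP[GI GB] [G0 Gmin Gmonic Gred]]; split.
  apply/groebnerP; split=> [_ /mapP[g gG ->]|h Ih h0].
    by apply: mem_ideal_gen; exists g => //; apply: GI.
  have [f [If f0 <-]] := lead_mon_extend_ideal Iid Ih h0.
  have [g gG gf] := GB f If f0; exists (map_mpoly iota g); first exact: map_f.
  by rewrite map_mpoly_iota_eq0 lead_mon_iota.
split.
- apply: contraNN G0 => /mapP[g gG /esym/eqP].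
  by rewrite map_mpoly_iota_eq0 => /eqP <-.
- move=> _ _ /mapP[f fG ->] /mapP[g gG ->] fg; rewrite !lead_mon_iota.
  by apply: Gmin => //; apply: contraNneq fg => ->.
- move=> _ /mapP[g gG ->]; rewrite /lead_cf lead_mon_iota mcoeff_map_mpoly.
  by have := Gmonic g gG; rewrite /lead_cf => ->; apply: rmorph1.
move=> _ m /mapP[g gG ->].
have -> : map_mpoly iota g - lead_term le (map_mpoly iota g)
   = map_mpoly iota (g - lead_term le g).
  rewrite /lead_term /lead_cf lead_mon_iota mcoeff_map_mpoly raddfB /=.
  by rewrite map_mpolyZ map_mpolyX.
rewrite msupp_iota => mg /lead_ideal_monP[_ [/mapP[f fG ->]]].
rewrite map_mpoly_iota_eq0 lead_mon_iota => f0 fm.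
by apply: Gred gG mg _; apply/lead_ideal_monP; exists f.
Qed.

End FieldExtension.
End MonomialOrder.

(** * Cycle decompositions *)

Lemma flatten_uniq_mem (T : eqType) (cs : seq (seq T)) c :
  uniq (flatten cs) -> c \in cs -> uniq c.
Proof.
move=> + /splitPr split_cs; case: split_cs => s1 s2.
by rewrite flatten_cat /= !cat_uniq => /and3P[_ _ /andP[]].
Qed.

Lemma flatten_uniq_disjoint (T : eqType) (cs : seq (seq T)) c1 c2 x :
  uniq (flatten cs) -> c1 \in cs -> c2 \in cs -> x \in c1 -> x \in c2 ->
  c1 = c2.
Proof.
elim: cs => //= c cs IHcs; rewrite cat_uniq => /and3P[_ /hasPn disj Ucs].
have notin d : d \in cs -> x \in d -> x \notin c.
  by move=> dcs xd; apply: disj; apply/flattenP; exists d.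
rewrite !inE => /predU1P[->|c1s] /predU1P[->|c2s] // xc1 xc2.
- by move: (notin _ c2s xc2); rewrite xc1.
- by move: (notin _ c1s xc1); rewrite xc2.
exact: IHcs.
Qed.

Lemma iter_next (T : eqType) (c : seq T) x0 i j : uniq c -> (i < size c)%N ->
  iter j (next c) (nth x0 c i) = nth x0 c ((i + j) %% size c).
Proof.
move=> Uc ltic; elim: j => [|j IHj] /=; first by rewrite addn0 modn_small.
have c_gt0 := leq_ltn_trans (leq0n _) ltic.
have ltr : ((i + j) %% size c < size c)%N by rewrite ltn_mod.
rewrite IHj next_nth mem_nth // index_uniq // addnS.
rewrite -addn1 -(modnDml (i + j) 1) addn1.
move: ((i + j) %% size c)%N ltr => r.
case: c Uc {ltic IHj c_gt0} => //= y c _ ltr.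
(* [c] is now the tail of the cycle. [next_nth] reads its position [r] with the head [y] as default
   value, so [r = size c] is the wrap-around. *)
have [ltr1|ger1] := ltnP r (size c).
  by rewrite modn_small //= (set_nth_default x0).
have -> : r = size c by apply/eqP; rewrite eqn_leq ger1 andbT.
by rewrite modnn /= nth_default.
Qed.

(** Taken at the order of [sigma], this makes each cycle length [l] divide [k], so that [k %/ l] is
    exact. *)
Lemma iter_next_id (T : eqType) (c : seq T) x j : uniq c -> x \in c ->
  iter j (next c) x = x -> (size c %| j)%N.
Proof.
move=> Uc xc; have ltx : (index x c < size c)%N by rewrite index_mem.
rewrite -{1}(nth_index x xc) iter_next // => E.
have c_gt0 := leq_ltn_trans (leq0n _) ltx.
have /eqP := congr1 (index^~ c) E; rewrite index_uniq ?ltn_mod //.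
rewrite -[X in _ == X](modn_small ltx) -[X in _ == X %[mod _]]addn0.
by rewrite eqn_modDl mod0n.
Qed.

Section CycleDecomposition.
Variables (n : nat) (sigma : 'S_n).

Lemma cycle_decomposition_exists : exists cs, cycle_decomposition sigma cs.
Proof.
have sigma_inj : injective sigma := perm_inj.
pose reps := [seq x <- enum 'I_n | froots sigma x].
exists [seq fingraph.orbit sigma x | x <- reps]; apply/and3P; split.
(* [perm_eq] is checked by counting: [y] occurs once in the orbit of its own root and in no other
   listed orbit. *)
- apply/allP => /= y _; rewrite count_flatten -map_comp.
  apply/eqP; rewrite count_uniq_mem ?enum_uniq // mem_enum sumnE big_map.
  have root_y : froot sigma y \in reps.
    by rewrite mem_filter mem_enum roots_root //; apply: fconnect_sym.
  have Ureps : uniq reps by rewrite filter_uniq ?enum_uniq.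
  rewrite (bigD1_seq _ root_y Ureps) /= big1_seq.
    rewrite addn0 count_uniq_mem ?orbit_uniq // -fconnect_orbit fconnect_sym //.
    by rewrite connect_root.
  move=> x /andP[xy]; rewrite mem_filter => /andP[/eqP rootx _].
  rewrite count_uniq_mem ?orbit_uniq // -fconnect_orbit; apply/eqP.
  rewrite eqb0; apply: contraNN xy.
  move=> /(fingraph.rootP (fconnect_sym sigma_inj)) <-.
  by rewrite rootx.
- by apply/mapP => [[x _ Ex]]; have := in_orbit sigma x; rewrite -Ex.
by apply/allP => _ /mapP[x _ ->]; apply: cycle_orbit.
Qed.

Variable cs : seq (seq 'I_n).
Hypothesis csP : cycle_decomposition sigma cs.

Lemma uniq_cycles : uniq (flatten cs).
Proof. by have /and3P[/perm_uniq-> _ _] := csP; rewrite enum_uniq. Qed.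

Lemma cycle_ofP e : cycle_of cs e \in cs /\ e \in cycle_of cs e.
Proof.
have /and3P[/perm_mem/(_ e) ecs _ _] := csP.
have he : has (fun c => e \in c) cs.
  by apply/hasP/flattenP; rewrite ecs mem_enum.
by split; [rewrite mem_nth -?has_find | apply: (nth_find [::] he)].
Qed.

Lemma cycle_of_uniq e : uniq (cycle_of cs e).
Proof. by apply: flatten_uniq_mem uniq_cycles _; case: (cycle_ofP e). Qed.

Lemma cycle_of_eq e e' : e' \in cycle_of cs e -> cycle_of cs e' = cycle_of cs e.
Proof.
move=> e'e; have [[ce _] [ce' e'e']] := (cycle_ofP e, cycle_ofP e').
exact: flatten_uniq_disjoint uniq_cycles ce' ce e'e' e'e.
Qed.

Lemma size_cycle_of_dvd e : (size (cycle_of cs e) %| #[sigma]%g)%N.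
Proof.
have [ce ee] := cycle_ofP e.
apply: (iter_next_id (cycle_of_uniq e) ee).
have /and3P[_ _ /allP/(_ _ ce) fc] := csP.
(* Along its own cycle [next] agrees with [sigma], whose power at its order fixes [e]. *)
suff -> j : iter j (next (cycle_of cs e)) e = (sigma ^+ j)%g e.
  by rewrite expg_order perm1.
elim: j => [|j IHj]; first by rewrite perm1.
rewrite iterS IHj expgSr permM (nextE fc) // -IHj.
by elim: j {IHj} => //= j IHj; rewrite mem_next.
Qed.

End CycleDecomposition.

(** * Discrete Fourier transform and invertibility of [tau] *)

Lemma sum_prim_root (L : fieldType) l (w : L) (p q : 'I_l) :
  l.-primitive_root w ->
  \sum_(i < l) (w ^+ p / w ^+ q) ^+ i = (p == q)%:R * l%:R.
Proof.
move=> prim_w; have [->|pq] := eqVneq p q.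
  have wq0 : w ^+ q != 0.
    rewrite expf_neq0 // (prim_root_eq0 prim_w).
    by rewrite -lt0n (prim_order_gt0 prim_w).
  rewrite divff // mul1r (eq_bigr (fun=> 1)) => [|i _]; last exact: expr1n.
  by rewrite sumr_const card_ord.
have ne1 : w ^+ p / w ^+ q != 1.
  apply: contraNneq pq => /divr1_eq /eqP.
  by rewrite (eq_prim_root_expr prim_w) !modn_small.
(* Multiplying the geometric sum by its ratio minus 1, which is nonzero, gives the [l]-th power of
   the ratio minus 1, which is zero. *)
apply: (mulfI (_ : w ^+ p / w ^+ q - 1 != 0)); first by rewrite subr_eq0.
rewrite -subrX1 mul0r mulr0 exprMn exprVn -!exprM ![(_ * l)%N]mulnC !exprM.
by rewrite (prim_expr_order prim_w) !expr1n divr1 subrr.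
Qed.

(** Substitutions are algebra morphisms, so checking the variables is enough. *)
Lemma comp_mpoly_cancel (R : comNzRingType) n (lp lq : n.-tuple {mpoly R[n]}) :
  (forall i, tnth lp i \mPo lq = 'X_i) ->
  cancel (fun f => f \mPo lp) (fun f => f \mPo lq).
Proof.
move=> lpq f; rewrite (comp_mpolyEX f) raddf_sum [RHS]mpolyE /=.
apply: eq_bigr => m _.
rewrite comp_mpolyZ comp_mpolyX rmorph_prod /= [in RHS]mpolyXE_id.
by congr (_ *: _); apply: eq_bigr => i _; rewrite rmorphXn /= lpq.
Qed.

Section Tau.
Variables (n : nat) (L : fieldType) (sigma : 'S_n) (xi : L).
Variable cs : seq (seq 'I_n).
Hypothesis csP : cycle_decomposition sigma cs.
Let k := #[sigma]%g.
Hypothesis prim_xi : k.-primitive_root xi.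

(** The coefficients [a] are the row at [q] of a left inverse of the matrix of [tau], obtained by
    Fourier inversion on the cycle of [q]. *)
Lemma tau_var_span q :
  exists a : 'I_n -> L, \sum_e a e *: tau_var k xi cs e = 'X_q.
Proof.
set c := cycle_of cs q; pose l := size c; pose w := xi ^+ (k %/ l).
have Uc : uniq c := cycle_of_uniq csP q.
have qc : q \in c by have [] := cycle_ofP csP q.
have prim_w : l.-primitive_root w.
  by apply: dvdn_prim_root => //; apply: size_cycle_of_dvd.
have l_neq0 := prim_root_natf_neq0 prim_w.
have ltq : (index q c < l)%N by rewrite index_mem.
(* With entries numbered from 0, tau maps x_{e_i} to the sum over p of
   w^(i (p - i)) x_{e_p}, that is, w^(-i^2) times the i-th component of the
   discrete Fourier transform; coef i i is the entry of the inverse matrix. *)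
pose coef i p := l%:R^-1 * (w ^+ p / w ^+ index q c) ^+ i.
exists (fun e => if e \in c then coef (index e c) (index e c) else 0).
rewrite (bigID (mem c)) /= [X in _ + X]big1 ?addr0 => [|e /negPf->]; last first.
  by rewrite scale0r.
rewrite -big_uniq // (big_nth q) big_mkord -/l.
transitivity (\sum_(i < l) \sum_(p < l)
    coef i p *: 'X_(nth q c p) : {mpoly L[n]}).
  apply: eq_bigr => i _; have ei : nth q c i \in c by rewrite mem_nth.
  rewrite ei /tau_var (cycle_of_eq csP ei) -/c -/l -/w index_uniq //.
  rewrite scaler_sumr.
  have l_gt0 : (0 < l)%N := leq_ltn_trans (leq0n _) ltq.
  (* Substituting [p = i + j] modulo [l] absorbs the factor [w ^+ (i * j)]: it turns [coef i i] into
     [coef i p]. *)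
  pose shift (j : 'I_l) := Ordinal (ltn_pmod (i + j) l_gt0).
  rewrite [RHS](reindex_inj (_ : injective shift)).
    apply: eq_bigr => j _; rewrite scalerA iter_next //; congr (_ *: _).
    rewrite /coef /= (prim_expr_mod prim_w) -mulrA; congr (_ * _).
    by rewrite mulnC exprM -exprMn mulrAC -exprD.
  move=> j1 j2 /(congr1 val) /= /eqP; rewrite eqn_modDl !modn_small //.
  by move/eqP/val_inj.
pose q' := Ordinal ltq.
(* Summing over [i] first, orthogonality leaves only the position [q'] of [q], and the factor [l]
   cancels. *)
rewrite exchange_big /= (bigD1 q') //= [X in _ + X]big1 ?addr0 => [|p pq].
  rewrite -scaler_suml -mulr_sumr (sum_prim_root q' q') //.
  by rewrite eqxx mul1r mulVf // scale1r nth_index.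
rewrite -scaler_suml -mulr_sumr (sum_prim_root p q') //.
by rewrite (negPf pq) mul0r mulr0 scale0r.
Qed.

(** [tau] substitutes the linear forms with matrix [M]. A left inverse [N] of a square matrix is
    two-sided, so substituting the linear forms of [N] inverts [tau] on both sides. *)
Lemma tau_bijective :
  exists t', cancel (tau k xi cs) t' /\ cancel t' (tau k xi cs).
Proof.
have [a aP] := fin_all_exists tau_var_span.
pose N : 'M[L]_n := \matrix_(q, e) a q e.
pose M : 'M[L]_n := \matrix_(e, p) (tau_var k xi cs e)@_U_(p).
have tau_varE e : tau_var k xi cs e = \sum_p M e p *: 'X_p.
  under eq_bigr do rewrite mxE /tau_var raddf_sum /= scaler_suml.
  rewrite exchange_big; apply: eq_bigr => j _; set x := iter j _ e.
  rewrite (bigD1 x) //= big1 ?addr0 => [|p px]; rewrite mcoeffZ mcoeffXU.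
    by rewrite eqxx mulr1.
  by rewrite eq_sym (negPf px) mulr0 scale0r.
have NM : N *m M = 1%:M.
  apply/matrixP => q p; rewrite !mxE.
  have := congr1 (mcoeff U_(p)) (aP q); rewrite mcoeffXU => <-.
  rewrite raddf_sum /=; apply: eq_bigr => e _; rewrite !mxE.
  by rewrite mcoeffZ.
have MN := mulmx1C NM.
pose t' (f : {mpoly L[n]}) := f \mPo [tuple \sum_e N q e *: 'X_e | q < n].
have tauX (A : 'M[L]_n) i lq :
    (\sum_j A i j *: 'X_j) \mPo lq = \sum_j A i j *: tnth lq j.
  rewrite raddf_sum; apply: eq_bigr => j _.
  by rewrite /= comp_mpolyZ comp_mpolyXU -tnth_nth.
have sumX (A B : 'M[L]_n) i : A *m B = 1%:M ->
    \sum_j A i j *: \sum_p B j p *: 'X_p = 'X_i :> {mpoly L[n]}.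
  move=> AB; under eq_bigr do rewrite scaler_sumr.
  rewrite exchange_big (bigD1 i) //= [X in _ + X]big1 ?addr0 => [|p pi].
    under eq_bigr do rewrite scalerA.
    rewrite -scaler_suml; have := congr1 (fun C : 'M_n => C i i) AB.
    by rewrite !mxE eqxx => ->; rewrite scale1r.
  under eq_bigr do rewrite scalerA.
  rewrite -scaler_suml; have := congr1 (fun C : 'M_n => C i p) AB.
  by rewrite !mxE eq_sym (negPf pi) => ->; rewrite scale0r.
exists t'; split; apply: comp_mpoly_cancel => i; rewrite !tnth_mktuple.
  rewrite tau_varE tauX; under eq_bigr do rewrite tnth_mktuple.
  exact: sumX.
rewrite tauX; under eq_bigr do rewrite tnth_mktuple tau_varE.
exact: sumX.
Qed.

End Tau.

(** * Primitive roots of unity, in [K] or in a quotient of [{poly K}] *)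

Lemma has_char_natr_eq0 (R : fieldType) c k :
  has_char R c -> (k%:R == 0 :> R) = (c %| k)%N.
Proof.
case: c => [/pcharf0P-> | c /dvdn_pcharf->//].
by rewrite dvd0n.
Qed.

(** By Fermat's little theorem the nonzero elements of the prime field are [p.-1] distinct roots of
    unity of that order, and so many force a primitive one. *)
Lemma prim_root_pred_pchar (K : fieldType) p :
  p \in [pchar K] -> exists z : K, (p.-1).-primitive_root z.
Proof.
move=> pK; have p_pr := pcharf_prime pK.
have p1_gt0 : (0 < p.-1)%N by rewrite -ltnS prednK ?prime_gt1 ?prime_gt0.
pose rs : seq K := [seq i.+1%:R | i <- iota 0 p.-1].
have natr_neq0 i : (0 < i < p)%N -> i%:R != 0 :> K.
  by case/andP=> i_gt0 ltip; rewrite -(dvdn_pcharf pK) gtnNdvd.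
suff /hasP[z _] : has (p.-1).-primitive_root rs by exists z.
apply: has_prim_root => //; last by rewrite size_map size_iota.
  apply/allP => _ /mapP[i + ->].
  rewrite mem_iota add0n unity_rootE => /andP[_ lti].
  have i0 : i.+1%:R != 0 :> K.
    by apply: natr_neq0; rewrite -ltn_predRL.
  rewrite -(inj_eq (mulfI i0)) -exprS prednK ?prime_gt0 // mulr1.
  by rewrite -(pFrobenius_autE pK) pFrobenius_aut_nat.
rewrite map_inj_in_uniq ?iota_uniq // => i j.
wlog leij : i j / (i <= j)%N.
  case/orP: (leq_total i j) => leij IH /[dup] ? /[swap] *; [|symmetry];
  exact: IH.
rewrite !mem_iota !add0n => /andP[_ lti] /andP[_ ltj] /esym/eqP.
rewrite -subr_eq0 -natrB ?ltnS // subSS => E.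
apply/eqP; rewrite eqn_leq leij -subn_eq0; apply: contraTT E.
rewrite -lt0n => d_gt0; apply: natr_neq0; rewrite d_gt0 /=.
by apply: leq_ltn_trans (leq_subr _ _) (leq_trans ltj (leq_pred _)).
Qed.

(** For [k = 2] the root is -1, which differs from 1 as the characteristic is not 2; for positive
    [c] it is a power of a primitive root of order [c - 1]. *)
Lemma prim_root_in_field (K : fieldType) c k : has_char K c ->
  (0 < k)%N -> ~~ (c %| k)%N ->
  (k == 2)%N || (((c%:Z - 1) %% k%:Z)%Z == 0) ->
  exists xi : K, k.-primitive_root xi.
Proof.
move=> hc k_gt0 ck.
case/predU1P => [k2|].
  exists (-1); rewrite k2 in ck *.
  have [|m prim_m] := @prim_order_exists K 2 (-1) isT.
    by rewrite sqrrN expr1n.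
  have /primeP[_ div2] : prime 2 by [].
  case/div2/pred2P=> [m1|<- //].
  have := prim_expr_order prim_m; rewrite m1 expr1 => /esym/eqP.
  by rewrite -subr_eq0 opprK -(natrD _ 1 1) (has_char_natr_eq0 _ hc) (negPf ck).
case: c hc ck => [|p] hc ck.
  (* In characteristic 0 the test says that [k] divides -1, so [k = 1]. *)
  rewrite sub0r => /eqP/dvdz_mod0P; rewrite dvdzE abszN dvdn1 => /eqP/= ->.
  have [m prim_m] := @prim_order_exists K 1 1 isT (expr1n _ _).
  by rewrite dvdn1 => /eqP <-; exists 1.
rewrite -[1]/(1%:Z) subzn // subn1 modz_nat => /eqP[km].
have [z prim_z] := prim_root_pred_pchar hc.
exists (z ^+ (p %/ k)); apply: (dvdn_prim_root prim_z).
by rewrite /dvdn km.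
Qed.

(** If [x] had order [m < k], it would also be a root of some ['Phi_d] with [d] dividing [m], hence
    a double root of ['X^k - 1], which is separable because [k] is nonzero in [L]. *)
Lemma root_Cyclotomic_prim (L : fieldType) k (x : L) : (0 < k)%N ->
  k%:R != 0 :> L -> root (map_poly intr 'Phi_k) x -> k.-primitive_root x.
Proof.
move=> k_gt0 kL rootx.
have prodE m : (0 < m)%N ->
    'X^m - 1 = \prod_(d <- divisors m) map_poly intr 'Phi_d :> {poly L}.
  move=> m0; rewrite -rmorph_prod /= prod_Cyclotomic //.
  by rewrite rmorphB /= map_polyXn rmorph1.
have xk1 : x ^+ k = 1.
  apply/eqP; rewrite -unity_rootE /root_of_unity prodE //.
  rewrite (big_rem k) ?divisors_id //=.
  by rewrite rootM rootx.
have [m prim_m mk] := prim_order_exists k_gt0 xk1.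
have [<- // | ne] := eqVneq m k; have m_gt0 := prim_order_gt0 prim_m.
have := separable_Xn_sub_1 kL; rewrite prodE // (big_rem k) ?divisors_id //=.
rewrite separable_mul => /and3P[_ _ cop]; move: (coprimep_root cop rootx).
have : root ('X^m - 1) x.
  by rewrite -[root _ _]/(m.-unity_root x) unity_rootE (prim_expr_order prim_m).
rewrite prodE // => /rootP; rewrite horner_prod => /eqP; rewrite prodf_seq_eq0.
case/hasP=> d dm /andP[_ rootd].
have dk : d \in rem k (divisors k).
  rewrite mem_rem_uniq ?divisors_uniq // inE -dvdn_divisors //.
  rewrite -dvdn_divisors // in dm; rewrite (dvdn_trans dm mk) andbT.
  by apply: contraNneq ne => dkE; rewrite eqn_dvd mk -dkE.
by rewrite horner_prod prodf_seq_neq0 => /allP/(_ d dk); rewrite rootd.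
Qed.

(** Descent on the size: excluded middle yields either a proper divisor or irreducibility, and in
    the latter case [p] is made monic. *)
Lemma monic_irreducible_factor (K : fieldType) (p : {poly K}) :
  (1 < size p)%N ->
  exists hh : {h : {poly K} | monic_irreducible_poly h}, sval hh %| p.
Proof.
have [s] := ubnP (size p); elim: s p => // s IHs p /ltnSE les gt1.
have p0 : p != 0 by rewrite -size_poly_gt0 ltnW.
case: (Classical_Prop.classic (exists q : {poly K},
  [/\ size q != 1, q %| p & ~~ (q %= p)])).
  case=> q [q1 qp neq]; have q0 : q != 0 by apply: dvdpN0 qp p0.
  have lt_qp : (size q < size p)%N.
    by rewrite ltn_neqAle dvdp_leq // dvdp_size_eqp // neq.
  have gt1q : (1 < size q)%N by rewrite ltn_neqAle eq_sym q1 size_poly_gt0.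
  have [hh hq] := IHs q (leq_trans lt_qp les) gt1q.
  by exists hh; apply: dvdp_trans hq qp.
move=> noq; have lc0 : (lead_coef p)^-1 != 0 by rewrite invr_eq0 lead_coef_eq0.
have irr : monic_irreducible_poly ((lead_coef p)^-1 *: p).
  split; last by rewrite monicE lead_coefZ mulVf // lead_coef_eq0.
  split=> [|q q1]; first by rewrite size_scale.
  rewrite dvdpZr // => qp; rewrite (eqp_rtrans (eqp_scale _ lc0)).
  by apply: contra_notT noq => neq; exists q.
by exists (exist _ _ irr); rewrite /= dvdpZl.
Qed.

(** Evaluating a polynomial over [K] at ['qX] amounts to reducing it modulo [h]. *)
Lemma qpolyX_root_Cyclotomic (K : fieldType) (h : {poly K})
    (hh : monic_irreducible_poly h) k : h %| map_poly intr 'Phi_k ->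
  root (map_poly intr 'Phi_k) ('qX : {poly %/ h with hh}).
Proof.
move=> hPhi; have := in_qpoly_comp_horner h (map_poly intr 'Phi_k) 'X.
rewrite comp_polyXr -map_poly_comp => E.
rewrite /root; apply/eqP.
transitivity (in_qpoly h (map_poly intr 'Phi_k)).
  rewrite E; congr (_ .[_]); apply: eq_map_poly => i /=.
  by rewrite rmorph_int.
apply: val_inj => /=; rewrite -Pdiv.IdomainMonic.modpE ?monic_mk_monic //.
by rewrite mk_monicE //; apply/eqP.
Qed.

(** The functional reads the coefficient at the degree of the representative of [x], so its value at
    [x] is a leading coefficient. It is [K]-linear since scaling a reduced representative leaves it
    reduced. *)
Lemma qpoly_separating (K : fieldType) (h : {poly K})
    (hh : monic_irreducible_poly h) (x : {poly %/ h with hh}) : x != 0 ->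
  exists phi : {additive {poly %/ h with hh} -> K},
    (forall a y, phi (qpolyC h a * y) = a * phi y) /\ phi x != 0.
Proof.
move=> x0; pose i := (size (val x)).-1.
pose phi (y : {poly %/ h with hh}) : K := (val y)`_i.
have phiB : zmod_morphism phi by move=> y z; rewrite /phi /= coefB.
pose phiA : {additive {poly %/ h with hh} -> K} :=
  HB.pack phi (GRing.isZmodMorphism.Build {poly %/ h with hh} K phi phiB).
exists phiA; split=> [a y|]; last first.
  by rewrite /= /phi -[_`_i]/(lead_coef _) lead_coef_eq0.
have valZ : val (qpolyC h a * y) = a *: val y.
  rewrite -mul_polyC; apply: in_qpoly_small; rewrite mul_polyC.
  exact: leq_ltn_trans (size_scale_leq _ _) (size_mk_monic y).
by rewrite /= /phi valZ coefZ.
Qed.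

(** * Preimages of lists and of generated ideals *)

Lemma sub_map_preimage (A B : eqType) (f : A -> B) (s : seq A) (t : seq B) :
  {subset t <= [seq f x | x <- s]} ->
  exists2 s', t = [seq f x | x <- s'] & {subset s' <= s}.
Proof.
elim: t => [|y t IHt] ts; first by exists [::].
have [|s' -> s's] := IHt; first by move=> z zt; apply: ts; rewrite inE zt orbT.
have /mapP[x xs ->] := ts y (mem_head _ _); exists (x :: s') => // z.
by rewrite inE => /predU1P[->|/s's].
Qed.

Section Transport.
Variables (R : comNzRingType) (t t' : R -> R).
Hypotheses (tK : cancel t t') (t'K : cancel t' t).
Hypotheses (tD : {morph t : x y / x + y}) (tM : {morph t : x y / x * y}).

Lemma image_is_ideal J : t 0 = 0 -> is_ideal J -> is_ideal (image_set t J).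
Proof.
move=> t0 [J0 JD JM]; split=> [|_ _ [f Jf ->] [g Jg ->]|a _ [f Jf ->]].
- by exists 0.
- by exists (f + g); rewrite ?tD //; apply: JD.
(* Surjectivity of [t] writes the arbitrary multiplier [a] as [t (t' a)]. *)
by exists (t' a * f); rewrite ?tM ?t'K //; apply: JM.
Qed.

Lemma ideal_gen_transport J (G : seq R) : is_ideal J ->
  (forall g, g \in G -> image_set t J g) ->
  (forall f, image_set t J f -> ideal_gen (fun g => g \in G) f) ->
  forall f, ideal_gen (fun g => g \in [seq t' g | g <- G]) f <-> J f.
Proof.
move=> Jid GJ genG f; set J' := ideal_gen _.
have [J'0 J'D J'M] : is_ideal J' := ideal_gen_is_ideal _.
have t'D : {morph t' : x y / x + y}.
  by move=> x y; apply: (can_inj tK); rewrite tD !t'K.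
split=> [|Jf].
  by apply: ideal_gen_min => // _ /mapP[g /GJ[h Jh ->] ->]; rewrite tK.
rewrite -(tK f); have Gtf : ideal_gen (fun g => g \in G) (t f).
  by apply: genG; exists f.
(* The preimage of [J'] under [t'] is an ideal containing [G], hence contains [t f]. *)
apply: (@ideal_gen_min _ _ (fun y => J' (t' y)) _ _ _ Gtf).
  split=> [|x y J'x J'y|a x J'x].
  - suff -> : t' 0 = 0 by [].
    by apply: (addrI (t' 0)); rewrite -t'D !addr0.
  - by rewrite t'D; apply: J'D.
  suff -> : t' (a * x) = t' a * t' x by apply: J'M.
  by apply: (can_inj tK); rewrite tM !t'K.
by move=> g gG; apply/mem_ideal_gen/map_f.
Qed.

End Transport.

(** * Correctness of both branches *)

Section Correctness.
Variables (n : nat) (le : rel 'X_{1..n}).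
Hypothesis le_deg : degree_ordering le.
Variable std : forall L : fieldType,
  ({mpoly L[n]} -> Prop) -> seq {mpoly L[n]}.
Hypothesis stdP : forall (L : fieldType) (J : {mpoly L[n]} -> Prop),
  is_ideal J -> reduced_groebner_basis le J (std J).
Variables (K : fieldType) (sigma : 'S_n) (I : {mpoly K[n]} -> Prop).
Hypothesis Iid : is_ideal I.

Lemma symmStd_over_correct (L : fieldType) (iota : {rmorphism K -> L}) xi :
  #[sigma]%g.-primitive_root xi ->
  (forall x : L, x != 0 -> exists phi : {additive L -> K},
     (forall a y, phi (iota a * y) = a * phi y) /\ phi x != 0) ->
  terminates_with
    (fun out : output K n =>
       exists2 G : seq {mpoly K[n]},
         out_basis out = [seq map_mpoly (out_emb out) g | g <- G]
         & reduced_groebner_basis le I G)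
    (symmStd_over std I sigma iota xi).
Proof.
move=> prim_xi sep; constructor; first exact: cycle_decomposition_exists.
move=> cs csP; constructor; first exact: tau_bijective.
set t := tau _ _ _ => t' [tK t'K]; constructor => /=.
set IL := ideal_gen (image_set (map_mpoly iota) I).
have ILid : is_ideal IL := ideal_gen_is_ideal _.
have tD : {morph t : x y / x + y} by move=> x y; rewrite /t /tau raddfD.
have tM : {morph t : x y / x * y} by move=> x y; rewrite /t /tau rmorphM.
have Jid : is_ideal (image_set t IL).
  by apply: (image_is_ideal t'K) => //; rewrite /t /tau raddf0.
have [GtB _] := stdP Jid.
set Gt := std (image_set t IL) in GtB *; set J' := ideal_gen _.
have J'E : forall f, J' f <-> IL f.
  apply: (ideal_gen_transport tK t'K tD tM ILid GtB.1) => f.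
  exact: (groebner_generates le_deg Jid GtB).
have G_IL : reduced_groebner_basis le IL (std J').
  apply: (eq_reduced_groebner_basis J'E).
  exact/stdP/ideal_gen_is_ideal.
have G0_IL : reduced_groebner_basis le IL [seq map_mpoly iota g | g <- std I]
  := reduced_groebner_extend le_deg sep Iid (stdP Iid).
have sub := reduced_groebner_sub le_deg ILid G_IL G0_IL.
have sub' := reduced_groebner_sub le_deg ILid G0_IL G_IL.
(* The list over [L] is lifted entry by entry into [std I]; injectivity of [map_mpoly iota] gives
   the converse inclusion, so [G] has the same members as [std I], possibly listed differently. *)
have [G GE subG] := sub_map_preimage sub; exists G => //.
apply: (eq_mem_reduced_groebner_basis _ (stdP Iid)) => g.
apply/idP/idP => [gI|/subG //].
have := sub' _ (map_f (map_mpoly iota) gI).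
by rewrite GE mem_map //; apply: map_mpoly_inj.
Qed.

End Correctness.

Theorem theorem3p12 (n : nat) (le : rel 'X_{1..n})
  (hle : degree_ordering le)
  (std : forall L : fieldType, ({mpoly L[n]} -> Prop) -> seq {mpoly L[n]})
  (hstd : forall (L : fieldType) (J : {mpoly L[n]} -> Prop),
     is_ideal J -> reduced_groebner_basis le J (std L J))
  (K : fieldType) (c : nat) (hc : has_char K c)
  (sigma : 'S_n) (hk : ~~ (c %| #[sigma]%g)%N)
  (I : {mpoly K[n]} -> Prop) (hI : is_ideal I)
  (hsymm : symmetric_ideal sigma I) :
  terminates_with
    (fun out : output K n =>
       exists2 G : seq {mpoly K[n]},
         out_basis out = [seq map_mpoly (out_emb out) g | g <- G]
         & reduced_groebner_basis le I G)
    (symmStd std I sigma c).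
Proof.
have k_gt0 : (0 < #[sigma]%g)%N := order_gt0 sigma.
(* The test for the early return is divisibility of the order by [c], which [hk] excludes. *)
rewrite /symmStd -/(dvdn c _) (negPf hk); case: ifP => [small|_].
  constructor; first exact: prim_root_in_field hc k_gt0 hk small.
  move=> xi prim_xi; apply: symmStd_over_correct prim_xi _ => // x x0.
  by exists idfun.
constructor.
  (* ['Phi_k] is monic, so its image over [K] keeps the size [(totient k).+1], which exceeds 1. *)
  apply: monic_irreducible_factor; rewrite size_poly_eq.
    by rewrite size_Cyclotomic ltnS totient_gt0.
  by rewrite -lead_coefE (monicP (Cyclotomic_monic _)) rmorph1 oner_eq0.
move=> hh hPhi; apply: symmStd_over_correct => //; last first.
  by move=> x; apply: qpoly_separating.
apply: root_Cyclotomic_prim => //; last exact: qpolyX_root_Cyclotomic.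
(* The order of [sigma] is nonzero in [K], hence in the quotient field, since field morphisms are
   injective. *)
pose iota : {rmorphism K -> {poly %/ sval hh with svalP hh}} :=
  qpolyC (sval hh).
rewrite -(rmorph_nat iota).
by rewrite fmorph_eq0 (has_char_natr_eq0 _ hc).
Qed.
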